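(* For all integers $N\ge 0$, $$MO(-1,3;15N+13)\equiv 0\pmod 5.$$
   Context: For an integer $a$ and a nonnegative integer $t$, define $MO(a,t;n)$ by the formal power series identity $$\sum_{n\ge 0}MO(a,t;n)\,q^n=\sum_{1\le n_1<n_2<\cdots<n_t}\frac{q^{n_1+n_2+\cdots+n_t}}{\prod_{k=1}^t(1+aq^{n_k}+q^{2n_k})},$$ where each factor $1/(1+aq^{m}+q^{2m})$ is expanded as a power series in $q$ with integer coefficients. *)

(* Defs.v *)
From HB Require Import structures.
From mathcomp Require Import all_boot all_order all_algebra.
From mathcomp Require Import all_classical.

Set Implicit Arguments.
Unset Strict Implicit.
Unset Printing Implicit Defensive.

Import Order.TTheory GRing.Theory Num.Theory.
Local Open Scope classical_set_scope.
Local Open Scope ring_scope.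

(* A formal power series is given by its sequence of coefficients. *)
Definition fps (R : Type) : Type := nat -> R.

Section FormalPowerSeries.
Variable R : comUnitRingType.
Implicit Types (f g : fps R) (p : {poly R}).

Definition fps_of_poly p : fps R := fun n => p`_n.

Definition fps_one : fps R := fps_of_poly 1.

Definition fps_mul f g : fps R :=
  fun n => \sum_(i < n.+1) f i * g (n - i)%N.

(* The first n + 1 coefficients of 1 / f, computed by long division. *)
Fixpoint fps_inv_seq f (n : nat) : seq R :=
  if n is m.+1 then
    let s := fps_inv_seq f m in
    rcons s (- (f 0%N)^-1 * \sum_(i < n) s`_i * f (n - i)%N)
  else [:: (f 0%N)^-1].

(* Meaningful only when the constant term of f is a unit, see fps_mulVf. *)
Definition fps_inv f : fps R := fun n => (fps_inv_seq f n)`_n.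

Lemma size_fps_inv_seq f n : size (fps_inv_seq f n) = n.+1.
Proof. by elim: n => //= n IHn; rewrite size_rcons IHn. Qed.

Lemma nth_fps_inv_seq f n i : (i <= n)%N -> (fps_inv_seq f n)`_i = fps_inv f i.
Proof.
elim: n => [|n IHn]; first by rewrite leqn0 => /eqP ->.
rewrite leq_eqVlt => /predU1P[-> //|]; rewrite ltnS => le_in.
by rewrite /= nth_rcons size_fps_inv_seq ltnS le_in IHn.
Qed.

Lemma fps_mulVf f : f 0%N \is a GRing.unit -> fps_mul (fps_inv f) f = fps_one.
Proof.
move=> uf; apply/funext => -[|n]; rewrite /fps_mul /fps_one /fps_of_poly coef1.
  by rewrite big_ord1 subnn /fps_inv /= mulVr.
rewrite big_ord_recr /= subnn {2}/fps_inv /= nth_rcons size_fps_inv_seq.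
rewrite ltnn eqxx mulrAC mulNr mulVr // mulN1r; apply/eqP; rewrite subr_eq0.
by apply/eqP/eq_bigr => i _; rewrite nth_fps_inv_seq // -ltnS.
Qed.

End FormalPowerSeries.

Definition MO_index (t : nat) : set (t.-tuple nat) :=
  [set s | sorted ltn s /\ (forall m, m \in (s : seq nat) -> (1 <= m)%N)].

Arguments MO_index : clear implicits.

Definition MO_factor (a : int) (m : nat) : fps int :=
  fps_inv (fps_of_poly (1 + a *: 'X^m + 'X^(2 * m))).

Definition MO_term (a : int) (t : nat) (s : t.-tuple nat) : fps int :=
  fps_mul (fps_of_poly 'X^(\sum_(m <- s) m)%N)
          (\big[@fps_mul int/fps_one int]_(m <- s) MO_factor a m).

(* The infinite sum of series is taken coefficientwise; each coefficient is a
   finitely supported sum by MO_term_finite, so that the convention giving the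
   value 0 to sums of infinite support is never used. *)
Definition MO (a : int) (t n : nat) : int :=
  \sum_(s \in MO_index t) MO_term a s n.

Lemma MO_factorP a m : (1 <= m)%N ->
  fps_mul (MO_factor a m) (fps_of_poly (1 + a *: 'X^m + 'X^(2 * m))) =
  fps_one int.
Proof.
case: m => // m _; apply: fps_mulVf.
by rewrite /fps_of_poly !coefD coefZ !coefXn coef1 /= mulr0 !addr0.
Qed.

Lemma MO_term_eq0 a t (s : t.-tuple nat) n :
  (n < \sum_(m <- s) m)%N -> MO_term a s n = 0.
Proof.
move=> lt_ns; rewrite /MO_term /fps_mul big1 // => i _.
rewrite /fps_of_poly coefXn ltn_eqF ?mul0r //.
by apply: leq_ltn_trans lt_ns; rewrite -ltnS.
Qed.

Lemma MO_term_finite a t n :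
  finite_set [set s : t.-tuple nat | MO_term a s n != 0].
Proof.
pose g (u : t.-tuple 'I_n.+1) : t.-tuple nat := [tuple of map val u].
apply: (@sub_finite_set _ _ (g @` setT)); last exact/finite_image/finite_finset.
move=> s /= nz; exists [tuple of map (@inord n) s] => //.
apply: val_inj; rewrite /= -map_comp -[RHS]map_id.
apply/eq_in_map => m ms /=; rewrite inordK // ltnS.
rewrite leqNgt; apply: contra nz => lt_nm; apply/eqP/MO_term_eq0.
by apply: leq_trans lt_nm _; rewrite (big_rem m) //= leq_addr.
Qed.

(* Main.v *)
Require Import Defs.
From mathcomp Require Import all_boot all_order all_algebra.
From mathcomp Require Import ring zify.
From mathcomp Require Import all_classical.

Set Implicit Arguments.
Unset Strict Implicit.
Unset Printing Implicit Defensive.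

Import GRing.Theory.
Local Open Scope ring_scope.

(* Write f_k for the product of the 1 - q^(k m), m >= 1, and T_n for the n-th
   triangular number. With x_m = q^m/(1 - q^m + q^(2m)), the generating function
   G of MO(-1, 3; n) is the z^3-coefficient of
     prod (1 + z x_m) = prod (1 + (z - 1) q^m + q^(2m)) / prod (1 - q^m + q^(2m)),
   and by the triple product f_1 prod (1 + (z - 1) q^m + q^(2m)) is the sum of
   the q^(T_n) V_n(z) with sum_n V_n t^n = (1 - t)/(1 + t + t^2 - z t). Hence
   G P = T, where P and T come from the coefficients of z^0 and z^3 in V_n.
   As (1 - t)^5 = 1 - t^5 modulo 5, the z^3-coefficients
   of the V_n make T a series in q^3, namely t(q^3) with
     t(q) = sum over all integers k of k(k+1)(k+2) q^(k(3k+1)/2).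
   Moreover P = a(q^3) - 2q psi(q^9) with psi = sum q^(T_n) and
   a = sum q^(k(3k+1)/2). Multiplying P by its conjugates under q -> w q, w a
   cube root of unity, gives the norm f_3^5 f_18/(f_6 f_9^2), whence the terms
   of G with exponent 1 modulo 3 are, by the products for psi, a and f_1^5 = f_5,
     2q (psi f_3^3 t)(q^3) / f_15.
   By Jacobi's formula for f_3^3, a term of psi f_3^3 t has exponent
   T_i + 3 T_j + k(3k+1)/2 and a coefficient divisible by
   (2j+1) k(k+1)(k+2). If the exponent is 4 modulo 5, looking at i, j, k modulo 5
   shows that 5 divides that coefficient.

   Instead of power series we compute in commutative rings with q^L = 0, finally
   in the polynomials over F_5 modulo 'X^L; then infinite products and sums are
   finite and q may be replaced by any of its powers. *)

(** * Powers and cancellation for nilpotent elements *)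

Section Nilpotent.
Variables (K : comNzRingType) (L : nat).
Implicit Types x : K.

Lemma nilp_exp x m : x ^+ L = 0 -> (0 < m)%N -> (x ^+ m) ^+ L = 0.
Proof. by move=> x0 m0; rewrite exprAC x0 expr0n eqn0Ngt m0. Qed.

Lemma exp_nilp x m : x ^+ L = 0 -> (L <= m)%N -> x ^+ m = 0.
Proof. by move=> x0 /subnKC <-; rewrite exprD x0 mul0r. Qed.

(** From y = x y follows y = x^2 y = ... = x^L y = 0. Cancelling factors 1 - q^m replaces most
    divisions below. *)
Lemma lreg_1sub_nilp x : x ^+ L = 0 -> GRing.lreg (1 - x).
Proof.
move=> x0; apply: GRing.mulrI0_lreg => y.
rewrite mulrBl mul1r => /subr0_eq e.
suff -> : y = x ^+ L * y by rewrite x0 mul0r.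
elim: L => [|n IHn]; first by rewrite mul1r.
by rewrite exprSr -mulrA -e.
Qed.

End Nilpotent.

(** * Gaussian binomials and the triple product *)

Definition euler (K : comNzRingType) (M : nat) (p : K) : K :=
  \prod_(i < M) (1 - p ^+ i.+1).

Section GaussianBinomial.
Variables (K : comNzRingType) (p : K).

(** The q-Pascal rule needs no division; [gbin_euler] gives back the usual quotient. *)
Fixpoint gbin (n k : nat) : K :=
  match n, k with
  | _, 0 => 1
  | 0, _.+1 => 0
  | n'.+1, k'.+1 => gbin n' k' + p ^+ k'.+1 * gbin n' k'.+1
  end.

Lemma eulerS M : euler M.+1 p = euler M p * (1 - p ^+ M.+1).
Proof. by rewrite /euler big_ord_recr. Qed.

Lemma gbin0 n : gbin n 0 = 1. Proof. by case: n. Qed.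

Lemma gbinS n k : gbin n.+1 k.+1 = gbin n k + p ^+ k.+1 * gbin n k.+1.
Proof. by []. Qed.

Arguments gbin : simpl never.

Lemma gbin_small n k : (n < k)%N -> gbin n k = 0.
Proof.
elim: n k => [|n IHn] [|k] //; rewrite ltnS => lt_nk.
by rewrite gbinS !IHn ?mulr0 ?addr0 // ltnW.
Qed.

(** Induction through 1 - p^(n+1) = (1 - p^(k+1)) + p^(k+1) (1 - p^(n-k)). *)
Lemma gbin_euler n k : (k <= n)%N ->
  gbin n k * (euler k p * euler (n - k) p) = euler n p.
Proof.
elim: n k => [|n IHn] [|k] le_kn //.
- by rewrite /= /euler !big_ord0 !mul1r.
- by rewrite gbin0 subn0 /euler big_ord0 !mul1r.
rewrite ltnS in le_kn; rewrite gbinS subSS.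
have IH1 := IHn k le_kn.
have [lt_kn|le_nk] := ltnP k n; last first.
  have -> : k = n by lia.
  have := IHn n (leqnn n); rewrite subnn [gbin n n.+1]gbin_small // !eulerS => H.
  by rewrite -[in RHS]H; ring.
have IH2 := IHn k.+1 lt_kn.
have e1 : (n - k = (n - k.+1).+1)%N by lia.
have e2 : p ^+ n.+1 = p ^+ k.+1 * p ^+ (n - k).
  by rewrite -exprD; congr (_ ^+ _); lia.
rewrite [in RHS]eulerS e2.
rewrite [LHS](_ : _ = (1 - p ^+ k.+1) * (gbin n k * (euler k p * euler (n - k) p))
  + p ^+ k.+1 * (1 - p ^+ (n - k)) *
    (gbin n k.+1 * (euler k.+1 p * euler (n - k.+1) p))); last first.
  by rewrite eulerS e1 eulerS; ring.
by rewrite IH1 IH2; ring.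
Qed.

Variable L : nat.
Hypothesis pL0 : p ^+ L = 0.

Lemma lreg_euler M : GRing.lreg (euler M p).
Proof.
rewrite /euler; elim/big_ind: _ => [||i _]; first exact: lreg1.
  exact: lregM.
by apply: (lreg_1sub_nilp (L := L)); exact: nilp_exp.
Qed.

Lemma gbin_sym n k : (k <= n)%N -> gbin n k = gbin n (n - k).
Proof.
move=> le_kn; apply: (lregM (@lreg_euler k) (@lreg_euler (n - k))).
have := gbin_euler (leq_subr k n); rewrite subKn // => e.
by rewrite /= ![_ * _ * gbin _ _]mulrC gbin_euler // -e [euler k p * _]mulrC.
Qed.

Lemma gbinS_sym n k : (k <= n)%N ->
  gbin n.+1 k.+1 = p ^+ (n - k) * gbin n k + gbin n k.+1.
Proof.
rewrite leq_eqVlt => /predU1P[->|lt_kn].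
  by rewrite gbinS subnn mul1r [gbin n n.+1]gbin_small ?mulr0.
rewrite gbin_sym; last by lia.
have -> : (n.+1 - k.+1 = (n - k.+1).+1)%N by lia.
rewrite gbinS -gbin_sym // addrC; congr (_ + _).
have -> : ((n - k.+1).+1 = n - k)%N by lia.
by rewrite -gbin_sym // ltnW.
Qed.

(** Both Pascal rules in turn lead from row n to row n + 2, as the odd rows in [jcoef] require. *)
Lemma gbinSS n k : (k <= n)%N ->
  gbin n.+2 k.+2 = (1 + p ^+ n.+1) * gbin n k.+1 + p ^+ (n - k) * gbin n k
                   + p ^+ k.+2 * gbin n k.+2.
Proof.
move=> le_kn; rewrite gbinS_sym; last by lia.
rewrite !gbinS.
have -> : p ^+ n.+1 = p ^+ (n - k) * p ^+ k.+1.
  by rewrite -exprD; congr (_ ^+ _); lia.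
have -> : (n.+1 - k.+1 = n - k)%N by lia.
ring.
Qed.

Lemma gbinSS1 n : gbin n.+2 1 = 1 + p ^+ n.+1 + p * gbin n 1.
Proof. by rewrite gbinS_sym // !gbinS !gbin0 subn0; ring. Qed.

(* The q-binomial [2M + 1, M - n]: the coefficient of the n-th term in the
   finite form of the triple product. *)
Definition jcoef M n := if (n <= M)%N then gbin M.*2.+1 (M - n) else 0.

Lemma jcoefS M n : (n <= M)%N ->
  jcoef M.+1 n.+1 = (1 + p ^+ M.*2.+2) * jcoef M n.+1 + p ^+ (M - n) * jcoef M n
                    + p ^+ (M + n + 3) * jcoef M n.+2.
Proof.
move=> le_nM; rewrite /jcoef ltnS le_nM subSS.
case e: (M - n)%N => [|[|j]].
- have -> : M = n by lia.
  by rewrite ltnn (leqNgt n.+2) ltnS leqnSn /= ?gbin0; ring.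
- rewrite ifT; last by lia.
  rewrite ifF; last by lia.
  have -> : (M - n.+1 = 0)%N by lia.
  by rewrite doubleS gbinSS1 gbin0; ring.
rewrite !ifT; try lia.
have -> : (M - n.+1 = j.+1)%N by lia.
have -> : (M - n.+2 = j)%N by lia.
rewrite doubleS gbinSS; last by lia.
have -> : (M.*2.+1 - j = M + n + 3)%N by lia.
ring.
Qed.

(** The rule of [jcoefS] read at n = -1, the missing term being supplied by the symmetry
    [2M + 1, M + 1] = [2M + 1, M]. *)
Lemma jcoefS0 M :
  jcoef M.+1 0 = (1 + p ^+ M.*2.+2 + p ^+ M.+1) * jcoef M 0
                 + p ^+ M.+2 * jcoef M 1.
Proof.
rewrite /jcoef /= !subn0.
case: M => [|M]; first by rewrite /= !gbinS !gbin0 /gbin; ring.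
rewrite /= subSS subn0 !doubleS gbinSS; last by lia.
have -> : (M.*2.+3 - M = M.+3)%N by lia.
rewrite (@gbin_sym M.*2.+3 M.+2); last by lia.
have -> : (M.*2.+3 - M.+2 = M.+1)%N by lia.
ring.
Qed.

(* If s = - p (u + 1/u), then h n = h 0 (-1)^n p^n (u^-n + ... + u^n), and
   triple_product is Jacobi's triple product divided by 1 - u. With s free, u
   need not be invertible or exist. *)
Section TripleProduct.
Variables (s : K) (h : nat -> K).
Hypotheses (h1 : h 1 = h 0 * (s - p))
  (hSS : forall n, h n.+2 = s * h n.+1 - p ^+ 2 * h n).

(** Induction on M. By [hSS], a term times s p^M splits into multiples of its two neighbours ([sh]);
    collected by index, these match [jcoefS]. *)
Lemma finite_triple_product M :
  h 0 * \prod_(i < M) (1 + s * p ^+ i + p ^+ i.*2.+2) =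
  \sum_(n < M.+1) p ^+ 'C(n, 2) * h n * jcoef M n.
Proof.
elim: M => [|M IHM].
  by rewrite big_ord0 big_ord1 /jcoef /= !mulr1 mul1r.
rewrite big_ord_recr /= mulrA IHM mulr_suml.
pose t n := p ^+ 'C(n, 2) * h n.
have sh n : (n < M)%N ->
  t n.+1 * (s * p ^+ M) = p ^+ (M - n.+1) * t n.+2 + p ^+ (M + n + 2) * t n.
  move=> lt_nM; rewrite /t.
  have -> : p ^+ 'C(n.+1, 2) * h n.+1 * (s * p ^+ M) =
    p ^+ 'C(n.+1, 2) * p ^+ M * (s * h n.+1) by ring.
  have -> : s * h n.+1 = h n.+2 + p ^+ 2 * h n by rewrite hSS; ring.
  rewrite mulrDr !mulrA -!exprD -!exprSr; congr (_ ^+ _ * _ + _ ^+ _ * _).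
    by rewrite [in RHS]binS bin1; lia.
  by rewrite binS bin1; lia.
(* The last two terms are exchanged across the cut between N and N + 1. *)
suff tele N : (N <= M)%N ->
    \sum_(n < N.+1) t n * jcoef M n * (1 + s * p ^+ M + p ^+ M.*2.+2) =
    \sum_(n < N.+1) t n * jcoef M.+1 n + p ^+ (M - N) * t N.+1 * jcoef M N
      - p ^+ (M + N + 2) * t N * jcoef M N.+1.
  rewrite tele // [RHS]big_ord_recr /= subnn /jcoef !leqnn ltnn !subnn !gbin0.
  by rewrite mulr0 subr0 mul1r.
elim: N => [|N IHN] leNM.
  rewrite !big_ord1 jcoefS0 /t /= h1 addn0 subn0 !bin0n /= expr0.
  by rewrite addn2 !exprSr; ring.
rewrite big_ord_recr [in RHS]big_ord_recr /= IHN; last exact: ltnW.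
rewrite jcoefS; last exact: ltnW.
have -> : (M + N.+1 + 2 = M + N + 3)%N by lia.
have := sh N leNM; move: (p ^+ (M - N.+1)) (p ^+ (M + N + 2)) => a b shN.
rewrite [X in _ + X](_ : _ = t N.+1 * jcoef M N.+1 * (1 + p ^+ M.*2.+2)
   + jcoef M N.+1 * (t N.+1 * (s * p ^+ M))); last by ring.
by rewrite shN; ring.
Qed.

(** As p^m = 0 for m >= L, the quotient formula makes [jcoef M n] inverse to [euler (M - n) p]. The
    further factors 1 - p^m of [euler M p], m > M - n, are absorbed by p^C(n,2), because C(n,2) + m
    >= M >= L. *)
Lemma euler_jcoef M n : (L <= M)%N -> (n <= M)%N ->
  p ^+ 'C(n, 2) * (euler M p * jcoef M n) = p ^+ 'C(n, 2).
Proof.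
move=> leLM lenM.
have p0 m : (L <= m)%N -> p ^+ m = 0 by exact: exp_nilp.
have stab d : euler (M + d) p = euler M p.
  elim: d => [|d IHd]; first by rewrite addn0.
  by rewrite addnS eulerS IHd p0 ?subr0 ?mulr1 //; lia.
have jE : euler (M - n) p * jcoef M n = 1.
  apply: (@lreg_euler M); rewrite mulr1 /jcoef lenM.
  have /gbin_euler : (M - n <= M.*2.+1)%N by lia.
  have -> : (M.*2.+1 - (M - n) = M + n.+1)%N by lia.
  have {2}-> : (M.*2.+1 = M + M.+1)%N by lia.
  by rewrite !stab => H; rewrite -[RHS]H; ring.
suff -> : p ^+ 'C(n, 2) * (euler M p * jcoef M n) =
    p ^+ 'C(n, 2) * (euler (M - n) p * jcoef M n) by rewrite jE mulr1.
rewrite !mulrA; congr (_ * _).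
have bin_ge m : (m <= ('C(m, 2)).+1)%N.
  by elim: m => // m IHm; rewrite binS bin1; lia.
suff e d : (d <= n)%N ->
    p ^+ 'C(n, 2) * euler (M - n + d) p = p ^+ 'C(n, 2) * euler (M - n) p.
  by rewrite -(e n) // subnK.
elim: d => [|d IHd] led; first by rewrite addn0.
rewrite addnS eulerS -[RHS]IHd ?(ltnW led) // mulrA mulrBr mulr1 mulrAC -exprD.
rewrite [p ^+ (_ + _)]p0 ?mul0r ?subr0 //.
have := bin_ge n; lia.
Qed.

Lemma triple_product B : (L < B)%N ->
  h 0 * (euler L p * \prod_(i < L) (1 + s * p ^+ i + p ^+ i.*2.+2)) =
  \sum_(n < B) p ^+ 'C(n, 2) * h n.
Proof.
move=> ltLB; rewrite mulrCA finite_triple_product mulr_sumr.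
(* Terms with n > L vanish, since then C(n,2) >= L. *)
rewrite -(subnKC ltLB) big_split_ord /= [X in _ = _ + X]big1 => [|i _].
  rewrite addr0; apply: eq_bigr => i _.
  by rewrite -[RHS](congr1 ( *%R^~ (h i)) (@euler_jcoef L i _ _)) ?leq_ord //; ring.
have : (L <= 'C(L.+1 + i, 2))%N.
  elim: (nat_of_ord i) => [|d IHd]; last by rewrite addnS binS; lia.
  by rewrite addn0 binS bin1; lia.
by move=> /subnKC <-; rewrite exprD pL0 !mul0r.
Qed.

End TripleProduct.
End GaussianBinomial.

(** * Product formulas for theta series *)

Lemma big_ord_mul3 (T : Type) (idx : T) (op : Monoid.law idx) (F : nat -> T) M :
  \big[op/idx]_(i < 3 * M) F i =
  \big[op/idx]_(i < M) op (F (3 * i)%N) (op (F (3 * i).+1) (F (3 * i).+2)).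
Proof.
elim: M => [|M IHM]; first by rewrite !big_ord0.
rewrite mulnS addnC !addnS addn0 !big_ord_recr IHM /=.
by rewrite -!Monoid.mulmA.
Qed.

Section Theta.
Variables (K : comNzRingType) (L : nat).
Implicit Types q x : K.

Lemma euler_stable q M : q ^+ L = 0 -> (L <= M)%N -> euler M q = euler L q.
Proof.
move=> q0 /subnKC <-; elim: (M - L)%N => [|d IHd]; first by rewrite addn0.
by rewrite addnS eulerS IHd (exp_nilp q0) ?subr0 ?mulr1 //; lia.
Qed.

Lemma euler_sqr q :
  euler L (q ^+ 2) = euler L q * \prod_(i < L) (1 + q ^+ i.+1).
Proof.
rewrite /euler -big_split; apply: eq_bigr => i _ /=.
by rewrite exprAC; ring.
Qed.

Definition psi (B : nat) q := \sum_(n < B) q ^+ 'C(n.+1, 2).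

(** Gauss's formula: the triple product at u = -1, whose product is that of the (1 + q^m)^2. *)
Lemma psi_euler B q : q ^+ L = 0 -> (L < B)%N ->
  psi B q * euler L q = euler L (q ^+ 2) ^+ 2.
Proof.
move=> q0 ltLB.
have := @triple_product K q L q0 (q *+ 2) (fun n => q ^+ n) _ _ B ltLB.
have -> : \prod_(i < L) (1 + q *+ 2 * q ^+ i + q ^+ i.*2.+2) =
    (\prod_(i < L) (1 + q ^+ i.+1)) ^+ 2.
  rewrite -prodrXl; apply: eq_bigr => i _.
  have -> : q ^+ i.*2.+2 = (q ^+ i.+1) ^+ 2 by rewrite -exprM; congr (_ ^+ _); lia.
  by rewrite [q ^+ i.+1]exprS; ring.
rewrite expr0 mul1r euler_sqr exprMn => H.
have -> : psi B q = \sum_(n < B) q ^+ 'C(n, 2) * q ^+ n.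
  by apply: eq_bigr => n _; rewrite -exprD binS bin1.
rewrite -H; [ring | by rewrite expr1; ring |].
by move=> n; rewrite !exprS; ring.
Qed.

Definition jacobi (B : nat) q :=
  \sum_(n < B) (-1) ^+ n * (n.*2.+1)%:R * q ^+ 'C(n.+1, 2).

(** Jacobi's formula: the triple product at u = 1, where u^-n + ... + u^n becomes 2n + 1. *)
Lemma euler_cube B q : q ^+ L = 0 -> (L < B)%N -> euler L q ^+ 3 = jacobi B q.
Proof.
move=> q0 ltLB.
have := @triple_product K q L q0 (- (q *+ 2))
  (fun n => (-1) ^+ n * (n.*2.+1)%:R * q ^+ n) _ _ B ltLB.
have -> : \prod_(i < L) (1 + - (q *+ 2) * q ^+ i + q ^+ i.*2.+2) = euler L q ^+ 2.
  rewrite -prodrXl; apply: eq_bigr => i _.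
  have -> : q ^+ i.*2.+2 = (q ^+ i.+1) ^+ 2 by rewrite -exprM; congr (_ ^+ _); lia.
  by rewrite [q ^+ i.+1]exprS; ring.
rewrite !expr0 !mul1r => H; rewrite [_ ^+ 3]exprS H; first 1 last.
- by rewrite !expr1 (_ : 1.*2.+1%:R = 3 :> K) //; ring.
- by move=> n; rewrite !exprS !doubleS -!natr1; ring.
by apply: eq_bigr => n _; rewrite binS bin1 exprD; ring.
Qed.

(* The numbers k(3k+1)/2 and (k+1)(3k+2)/2. *)
Definition pent1 k := (3 * 'C(k, 2) + 2 * k)%N.
Definition pent2 k := (3 * 'C(k, 2) + 4 * k + 1)%N.
Definition pentagonal (B : nat) q := \sum_(k < B) (q ^+ pent1 k + q ^+ pent2 k).

(** The triple product with p = q^3 and u = -q, times 1 + q to clear the denominator of the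
    geometric sum in h. It yields f_3 times the product of the 1 + q^m with m prime to 3. *)
Lemma pentagonal_euler B q : q ^+ L = 0 -> (L < B)%N ->
  pentagonal B q * euler L q * euler L (q ^+ 6) =
  euler L (q ^+ 2) * euler L (q ^+ 3) ^+ 2.
Proof.
move=> q0 ltLB; have q30 : (q ^+ 3) ^+ L = 0 by exact: nilp_exp.
have := @triple_product K (q ^+ 3) L q30 (q ^+ 2 + q ^+ 4)
  (fun n => q ^+ (2 * n) * (1 + q ^+ (2 * n).+1)) _ _ B ltLB.
rewrite muln0 expr0 mul1r expr1 => H.
have {H} -> : pentagonal B q = (1 + q) * (euler L (q ^+ 3) *
    \prod_(i < L) ((1 + q ^+ (3 * i).+2) * (1 + q ^+ (3 * i).+4))).
  transitivity ((1 + q) * (euler L (q ^+ 3) *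
     \prod_(i < L) (1 + (q ^+ 2 + q ^+ 4) * (q ^+ 3) ^+ i + (q ^+ 3) ^+ i.*2.+2))).
    rewrite H; first 1 last.
    - by rewrite muln1; ring.
    - move=> n; rewrite !mulnS !addSn !add0n !exprS; ring.
    apply: eq_bigr => n _; rewrite -exprM /pent1 /pent2 mulrA -exprD mulrDr mulr1.
    by rewrite -exprD; congr (_ + _ ^+ _); lia.
  congr (_ * (_ * _)); apply: eq_bigr => i _.
  rewrite -!exprM mulrDl -!exprD.
  have -> : (3 * i.*2.+2 = (3 * i).+2 + (3 * i).+4)%N by lia.
  by move: (3 * i)%N => m; rewrite !(addSn, add0n, exprS) exprD !exprS; ring.
(* The factor 1 + q turns the factors 1 + q^(3i+4) into 1 + q^(3i+1); the surplus 1 + q^(3M+1) is 1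
   for M = L. *)
have shift M : (1 + q) * \prod_(i < M) ((1 + q ^+ (3 * i).+2) * (1 + q ^+ (3 * i).+4)) =
    \prod_(i < M) ((1 + q ^+ (3 * i).+1) * (1 + q ^+ (3 * i).+2)) * (1 + q ^+ (3 * M).+1).
  elim: M => [|M IHM]; first by rewrite !big_ord0 muln0 expr1; ring.
  rewrite !big_ord_recr /= mulrA IHM.
  have -> : (3 * M.+1).+1 = (3 * M).+4 by lia.
  ring.
rewrite mulrCA shift (exp_nilp q0 (m := (3 * L).+1)); last by lia.
have -> : euler L (q ^+ 6) =
    euler L (q ^+ 3) * \prod_(i < L) (1 + q ^+ (3 * i).+3).
  have -> : q ^+ 6 = (q ^+ 3) ^+ 2 by rewrite -exprM.
  rewrite euler_sqr; congr (_ * _); apply: eq_bigr => i _.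
  by rewrite -exprM; congr (1 + _ ^+ _); lia.
have e3 : \prod_(i < (3 * L)) (1 + q ^+ i.+1) =
   \prod_(i < L) ((1 + q ^+ (3 * i).+1) * (1 + q ^+ (3 * i).+2)) *
   \prod_(i < L) (1 + q ^+ (3 * i).+3).
  rewrite (big_ord_mul3 _ (fun i => 1 + q ^+ i.+1)) -big_split /=.
  by apply: eq_bigr => i _; rewrite mulrA.
have -> : euler L (q ^+ 2) = euler L q * \prod_(i < (3 * L)) (1 + q ^+ i.+1).
  rewrite -(@euler_stable (q ^+ 2) (3 * L)) ?nilp_exp //; last by lia.
  rewrite -(@euler_stable q (3 * L)) //; last by lia.
  rewrite /euler -big_split; apply: eq_bigr => i _ /=.
  by rewrite exprAC; ring.
by rewrite e3; ring.
Qed.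

End Theta.

(** * The polynomials V_n and their coefficients modulo 5 *)

Section Chebyshev.
Variable K : comNzRingType.

Fixpoint cheb2 (n : nat) : {poly K} * {poly K} :=
  if n is m.+1 then
    let: (u, v) := cheb2 m in (v, ('X - 1) * v - u)
  else (1, 'X - 2%:P).

(* The polynomial (-1)^n (u^-n + ... + u^n) in 'X, where u + 1/u = 1 - 'X. *)
Definition cheb n := (cheb2 n).1.

Lemma chebSS n : cheb n.+2 = ('X - 1) * cheb n.+1 - cheb n.
Proof. by rewrite /cheb /=; case: (cheb2 n). Qed.

Lemma coef_chebSS n j : (cheb n.+2)`_j =
  (if j is j'.+1 then (cheb n.+1)`_j' else 0) - (cheb n.+1)`_j - (cheb n)`_j.
Proof. by rewrite chebSS mulrBl mul1r !coefB coefXM; case: j. Qed.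

Hypothesis K5 : 5%:R = 0 :> K.

(** With the quotient w given, a congruence modulo 5 becomes an identity of integer polynomials. *)
Lemma eq_mod5 (a b w : K) : a - b = 5%:R * w -> a = b.
Proof. by rewrite K5 mul0r => /subr0_eq. Qed.

(** The z^j-coefficients of the V_n have generating function t^j (1 - t)^(j+2) / (1 - t^3)^(j+1).
    For j = 3 the numerator is t^3 - t^8 modulo 5, so no exponent is 1 modulo 3; 6 = 1 clears the
    denominator of the binomials. The induction needs all j <= 3 together. *)
Lemma coef_cheb_mul3 k (x := k%:R : K) :
  [/\ (cheb (3 * k))`_0 = 1, (cheb (3 * k))`_1 = 3%:R * x,
      (cheb (3 * k))`_2 = x ^+ 2 &
      (cheb (3 * k))`_3 = x * (x + 1) * (x + 2%:R)] /\
  [/\ (cheb (3 * k).+1)`_0 = - 2%:R, (cheb (3 * k).+1)`_1 = 1,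
      (cheb (3 * k).+1)`_2 = 3%:R * x * (x + 1) & (cheb (3 * k).+1)`_3 = 0].
Proof.
rewrite {}/x; elim: k => [|k [[a0 a1 a2 a3] [b0 b1 b2 b3]]].
  rewrite muln0 /cheb /= !coefB !coef1 !coefX !coefC /=.
  by split; split; ring.
rewrite -[k.+1%:R]natr1; move: (k%:R : K) a1 a2 a3 b2 => x a1 a2 a3 b2.
have -> : (3 * k.+1 = (3 * k).+3)%N by lia.
have c0 : (cheb (3 * k).+2)`_0 = 1 by rewrite coef_chebSS b0 a0; ring.
have c1 : (cheb (3 * k).+2)`_1 = - 3%:R * (x + 1).
  by rewrite coef_chebSS b0 b1 a1; ring.
have c2 : (cheb (3 * k).+2)`_2 = (x + 1) ^+ 2.
  by apply: (@eq_mod5 _ _ (- (x + x ^+ 2))); rewrite coef_chebSS b1 b2 a2; ring.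
have c3 : (cheb (3 * k).+2)`_3 = - (x + 1) * x * (x - 1).
  by rewrite coef_chebSS b2 b3 a3; ring.
have d0 : (cheb (3 * k).+3)`_0 = 1 by rewrite coef_chebSS c0 b0; ring.
have d1 : (cheb (3 * k).+3)`_1 = 3%:R * (x + 1).
  by rewrite coef_chebSS c0 c1 b1; ring.
have d2 : (cheb (3 * k).+3)`_2 = (x + 1) ^+ 2.
  by apply: (@eq_mod5 _ _ (- (x + 1) ^+ 2)); rewrite coef_chebSS c1 c2 b2; ring.
have d3 : (cheb (3 * k).+3)`_3 = (x + 1) * (x + 1 + 1) * (x + 1 + 2%:R).
  by apply: (@eq_mod5 _ _ (- (x + 1) ^+ 2)); rewrite coef_chebSS c2 c3 b3; ring.
split; split=> //.
- by rewrite coef_chebSS d0 c0; ring.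
- by rewrite coef_chebSS d0 d1 c1; ring.
- by apply: (@eq_mod5 _ _ (- (x + 1) ^+ 2)); rewrite coef_chebSS d1 d2 c2; ring.
- by apply: (@eq_mod5 _ _ (- (x + 1) ^+ 2)); rewrite coef_chebSS d2 d3 c3; ring.
Qed.

Lemma coef_cheb_mul3D2 k (x := k%:R : K) :
  (cheb (3 * k).+2)`_0 = 1 /\
  (cheb (3 * k).+2)`_3 = - (x + 1) * x * (x - 1).
Proof.
have [[a0 a1 a2 a3] [b0 b1 b2 b3]] := coef_cheb_mul3 k.
by rewrite !coef_chebSS a0 a3 b0 b2 b3 /x; split; ring.
Qed.

Variables (L : nat) (q : K).
Hypothesis q0 : q ^+ L = 0.

Lemma cheb_product B : (L < B)%N ->
  (euler L q)%:P *
    \prod_(i < L) (1 + ('X - 1) * (q ^+ i.+1)%:P + (q ^+ i.*2.+2)%:P) =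
  \sum_(n < B) (q ^+ 'C(n.+1, 2))%:P * cheb n.
Proof.
move=> ltLB; have q0P : q%:P ^+ L = 0 :> {poly K} by rewrite -rmorphXn q0 rmorph0.
have := @triple_product {poly K} q%:P L q0P (('X - 1) * q%:P)
  (fun n => q%:P ^+ n * cheb n) _ _ B ltLB.
rewrite /= expr0 (_ : cheb 0 = 1) // !mul1r => H.
transitivity (euler L q%:P *
  \prod_(i < L) (1 + ('X - 1) * q%:P * q%:P ^+ i + q%:P ^+ i.*2.+2)).
  congr (_ * _); last by apply: eq_bigr => i _; rewrite !rmorphXn exprS mulrA.
  rewrite /euler rmorph_prod; apply: eq_bigr => i _.
  by rewrite rmorphB rmorph1 rmorphXn.
rewrite H; first 1 last.
- by rewrite /cheb /=; ring.
- by move=> n; rewrite chebSS !exprS; ring.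
by apply: eq_bigr => n _; rewrite mulrA -exprD rmorphXn binS bin1.
Qed.

(** P and T are the cases j = 0 and j = 3. With 3B terms, each class of n modulo 3 contributes B of
    them. *)
Definition cheb_theta B j (x : K) :=
  \sum_(n < (3 * B)) x ^+ 'C(n.+1, 2) * (cheb n)`_j.

Lemma coef_cheb_product B j : (L < B)%N ->
  cheb_theta B j q = euler L q *
    (\prod_(i < L) (1 + ('X - 1) * (q ^+ i.+1)%:P + (q ^+ i.*2.+2)%:P))`_j.
Proof.
move=> ltLB; rewrite -coefCM (@cheb_product (3 * B)); last by lia.
by rewrite coef_sum; apply: eq_bigr => n _; rewrite coefCM.
Qed.

Lemma bin_mul3 k : ('C((3 * k).+1, 2) = 3 * pent1 k)%N.
Proof.
by elim: k => // k; rewrite mulnS !addSn add0n /pent1 !binS !bin1 !bin0; lia.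
Qed.

Lemma bin_mul3D1 k : ('C((3 * k).+2, 2) = 9 * 'C(k.+1, 2) + 1)%N.
Proof.
by rewrite binS bin1 bin_mul3 /pent1 [in RHS]binS bin1; lia.
Qed.

Lemma bin_mul3D2 k : ('C((3 * k).+3, 2) = 3 * pent2 k)%N.
Proof.
by rewrite binS bin1 bin_mul3D1 /pent2 binS bin1; lia.
Qed.

Lemma cheb_theta0 B x :
  cheb_theta B 0 x = pentagonal B (x ^+ 3) - 2%:R * x * psi B (x ^+ 9).
Proof.
rewrite /cheb_theta (big_ord_mul3 _ (fun n => x ^+ 'C(n.+1, 2) * (cheb n)`_0)).
rewrite /pentagonal /psi mulr_sumr -sumrB; apply: eq_bigr => k _.
have [[-> _ _ _] [-> _ _ _]] := coef_cheb_mul3 k.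
have [-> _] := coef_cheb_mul3D2 k.
rewrite bin_mul3 bin_mul3D1 bin_mul3D2 -!exprM [x ^+ (_ + 1)]exprD /=; ring.
Qed.

(** This is t(x): the second summand is the first one at -k - 1. *)
Definition cubic_pentagonal B x := \sum_(k < B)
  (k%:R * (k%:R + 1) * (k%:R + 2%:R) * x ^+ pent1 k
   - (k%:R + 1) * k%:R * (k%:R - 1) * x ^+ pent2 k) : K.

Lemma cheb_theta3 B x : cheb_theta B 3 x = cubic_pentagonal B (x ^+ 3).
Proof.
rewrite /cheb_theta (big_ord_mul3 _ (fun n => x ^+ 'C(n.+1, 2) * (cheb n)`_3)).
apply: eq_bigr => k _.
have [[_ _ _ ->] [_ _ _ ->]] := coef_cheb_mul3 k.
have [_ ->] := coef_cheb_mul3D2 k.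
rewrite bin_mul3 bin_mul3D2 -!exprM /=; ring.
Qed.

End Chebyshev.

(** * Conjugates under a cube root of unity *)

Section CubeRootOfUnity.
Variables (K : comNzRingType) (w : K).
Hypothesis w_root : w ^+ 2 + w + 1 = 0.

Lemma cube_root1 : w ^+ 3 = 1.
Proof.
apply/eqP; rewrite -subr_eq0 (_ : _ - 1 = (w - 1) * (w ^+ 2 + w + 1)); last by ring.
by rewrite w_root mulr0.
Qed.

Lemma cube_root_factor (y : K) : (1 - y) * (1 - w * y) * (1 - w ^+ 2 * y) = 1 - y ^+ 3.
Proof.
rewrite [LHS](_ : _ = 1 - w ^+ 3 * y ^+ 3
   - (w ^+ 2 + w + 1) * (y - w * y ^+ 2)); last by ring.
by rewrite cube_root1 w_root mul1r mul0r subr0.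
Qed.

(** The three conjugates of 1 - q^m multiply to 1 - q^(3m) if 3 does not divide m, and to (1 -
    q^m)^3 otherwise. *)
Lemma euler_norm L (q : K) : q ^+ L = 0 ->
  euler L q * euler L (w * q) * euler L (w ^+ 2 * q) * euler L (q ^+ 9) =
  euler L (q ^+ 3) ^+ 4.
Proof.
move=> q0.
have split3 (x : K) : x ^+ L = 0 -> euler L x = \prod_(i < L)
    ((1 - x ^+ (3 * i).+1) * ((1 - x ^+ (3 * i).+2) * (1 - x ^+ (3 * i).+3))).
  move=> x0; rewrite -(@euler_stable _ L x (3 * L)) //; last by lia.
  exact: (big_ord_mul3 _ (fun i => 1 - x ^+ i.+1)).
have e9 : euler L (q ^+ 9) = \prod_(i < L) (1 - (q ^+ (3 * i).+3) ^+ 3).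
  by apply: eq_bigr => i _; rewrite -!exprM; congr (1 - _ ^+ _); lia.
have e3 : euler L (q ^+ 3) = \prod_(i < L) (1 - q ^+ (3 * i).+3).
  by apply: eq_bigr => i _; rewrite -!exprM; congr (1 - _ ^+ _); lia.
have q30 : (q ^+ 3) ^+ L = 0 by exact: nilp_exp.
rewrite [in RHS]exprS {1}(split3 _ q30) e3 -prodrXl e9.
rewrite !(split3 _) ?exprMn ?q0 ?mulr0 // -!big_split /=.
apply: eq_bigr => i _; rewrite !(exprAC q 3).
have w1 : w ^+ (3 * i).+1 = w by rewrite exprS exprM cube_root1 expr1n mulr1.
have w2 : w ^+ (3 * i).+2 = w ^+ 2 by rewrite exprS w1.
have w3 : w ^+ (3 * i).+3 = 1 by rewrite exprS w2 -exprS cube_root1.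
rewrite ![(w * q) ^+ _]exprMn ![(w ^+ 2 * q) ^+ _]exprMn ![(w ^+ 2) ^+ _]exprAC.
rewrite w1 w2 w3 !expr1n !mul1r -!cube_root_factor.
have -> : (w ^+ 2) ^+ 2 = w by rewrite -exprM exprS cube_root1 mulr1.
ring.
Qed.

End CubeRootOfUnity.

(** F_5 contains no such w, so the class of X modulo X^2 + X + 1 is adjoined; constants inject
    because this polynomial is monic of degree 2. *)
Lemma exists_cube_root (K : comNzRingType) :
  exists (K' : comNzRingType) (f : {rmorphism K -> K'}) (w : K'),
    injective f /\ w ^+ 2 + w + 1 = 0.
Proof.
pose h : {poly K} := 'X^2 + ('X + 1).
have sz : size h = 3.
  rewrite size_polyDl size_polyXn // -['X]mul1r -polyC1 size_MXaddC size_polyC.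
  by case: ifP => _ //; rewrite oner_eq0.
have hm : h \is monic.
  by apply/monicP; rewrite lead_coefE sz /h !coefD coefXn coefX coef1 /= !addr0.
exists {poly %/ h}, (qpolyC h : {rmorphism _ -> _}), (in_qpoly h 'X); split.
  by move=> x y /(congr1 val) /= /polyC_inj.
rewrite -rmorphXn -rmorphD -(rmorph1 (in_qpoly h)) -rmorphD -addrA.
by apply/val_inj; rewrite /= /mk_monic sz hm /= Pdiv.RingMonic.rmodpp.
Qed.

(** * The norm of P *)

Section CubicIdentity.
Variables L B : nat.
Hypothesis ltLB : (L < B)%N.

(** At z = 0 each factor is 1 - x^m + x^(2m) = (1 + x^(3m)) / (1 + x^m). *)
Lemma cheb_theta0_euler (K : comNzRingType) (x : K) : x ^+ L = 0 ->
  cheb_theta B 0 x * (euler L (x ^+ 2) * euler L (x ^+ 3)) =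
  euler L x ^+ 2 * euler L (x ^+ 6).
Proof.
move=> x0; rewrite (coef_cheb_product x0) // -horner_coef0 horner_prod.
have -> : x ^+ 6 = (x ^+ 3) ^+ 2 by rewrite -exprM.
rewrite !euler_sqr.
have e3 : \prod_(i < L) (1 + (x ^+ 3) ^+ i.+1) = \prod_(i < L) (1 + x ^+ i.+1) *
    \prod_(i < L) (1 + ('X - 1) * (x ^+ i.+1)%:P + (x ^+ i.*2.+2)%:P).[0].
  rewrite -big_split; apply: eq_bigr => i _ /=.
  rewrite !hornerE exprAC (_ : x ^+ i.*2.+2 = (x ^+ i.+1) ^+ 2); first by ring.
  by rewrite -exprM; congr (_ ^+ _); lia.
by rewrite e3; ring.
Qed.

(* Take the product of cheb_theta0_euler over q, w q and w^2 q: on the theta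
   side this is a norm, as both functions of cheb_theta0 but the factor q are
   invariant under q -> w q. *)
Lemma cubic_identity_of_cube_root (K : comNzRingType) (w q : K) :
  5%:R = 0 :> K -> w ^+ 2 + w + 1 = 0 -> q ^+ L = 0 ->
  (pentagonal B (q ^+ 3) ^+ 3 - 8%:R * q ^+ 3 * psi B (q ^+ 9) ^+ 3)
    * (euler L (q ^+ 6) * euler L (q ^+ 9) ^+ 2) =
  euler L (q ^+ 3) ^+ 5 * euler L (q ^+ 18).
Proof.
move=> K5 w0 q0; have w3 := cube_root1 w0.
have nilM y : (y * q) ^+ L = 0 by rewrite exprMn q0 mulr0.
have wX m : (w * q) ^+ (3 * m) = q ^+ (3 * m).
  by rewrite !exprM [(w * q) ^+ 3]exprMn w3 mul1r.
have w2X m : (w ^+ 2 * q) ^+ (3 * m) = q ^+ (3 * m).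
  by rewrite !exprM [(w ^+ 2 * q) ^+ 3]exprMn [(w ^+ 2) ^+ 3]exprAC w3 expr1n mul1r.
have := cheb_theta0_euler q0; have := cheb_theta0_euler (nilM w).
have := cheb_theta0_euler (nilM (w ^+ 2)).
rewrite !cheb_theta0 // (wX 1) (wX 2) (wX 3) (w2X 1) (w2X 2) (w2X 3).
have w4 : (w ^+ 2) ^+ 2 = w by rewrite -exprM exprS w3 mulr1.
rewrite [(w * q) ^+ 2]exprMn [(w ^+ 2 * q) ^+ 2]exprMn w4.
have n1 := euler_norm w0 q0.
have := euler_norm w0 (nilp_exp q0 (isT : (0 < 2)%N)).
rewrite -!exprM /=.
move: (pentagonal _ _) (psi _ _) => a p n2 e2 e1 e0.
set N := a ^+ 3 - _.
have NE : N = (a - 2%:R * q * p) * (a - 2%:R * (w * q) * p) * (a - 2%:R * (w ^+ 2 * q) * p).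
  rewrite /N [RHS](_ : _ = a ^+ 3 - 8%:R * w ^+ 3 * q ^+ 3 * p ^+ 3
    - (w ^+ 2 + w + 1) * (2%:R * a ^+ 2 * q * p - 4%:R * w * a * q ^+ 2 * p ^+ 2));
    last by ring.
  by rewrite w0 w3 mul0r subr0 mulr1.
have reg j : (0 < j)%N -> GRing.lreg (euler L (q ^+ j)).
  by move=> j0; apply: (@lreg_euler _ _ L); exact: nilp_exp.
(* Multiplying by f_3^3 f_6^3 provides the f_3 of each of [e0], [e1], [e2], and the f_6^4 for the
   norm [n2] at q^2. *)
apply: (lregM (lregX (n := 3) (reg 3 isT)) (lregX (n := 3) (reg 6 isT))).
move: n1 n2 e0 e1 e2.
rewrite (_ : (3 * 1)%N = 3) // (_ : (2 * 9)%N = 18) // (_ : (2 * 3)%N = 6) // NE.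
move: (a - 2%:R * q * p) (a - 2%:R * (w * q) * p) => c0 c1.
move: (a - 2%:R * (w ^+ 2 * q) * p) => c2.
move: (euler L q) (euler L (w * q)) (euler L (w ^+ 2 * q)) => f0 f1 f2.
move: (euler L (q ^+ 2)) (euler L (w * q ^+ 2)) (euler L (w ^+ 2 * q ^+ 2)) => b0 b1 b2.
move: (euler L (q ^+ 3)) (euler L (q ^+ 6)) (euler L (q ^+ 9)) => F3 F6 F9.
move: (euler L (q ^+ 18)) => F18 n1 n2 e0 e1 e2.
transitivity (c0 * c1 * c2 * F3 ^+ 3 * F9 ^+ 2 * F6 ^+ 4); first by ring.
rewrite -n2.
(* [c1] goes with [b2] since (w q)^2 = w^2 q^2, and [c2] with [b1] since (w^2 q)^2 = w q^2. *)
transitivity ((c0 * (b0 * F3)) * (c1 * (b2 * F3)) * (c2 * (b1 * F3)) * F9 ^+ 2 * F18).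
  by ring.
rewrite e0 e1 e2.
transitivity ((f0 * f1 * f2 * F9) ^+ 2 * F6 ^+ 3 * F18); first by ring.
by rewrite n1; ring.
Qed.

Lemma pentagonal_morph (K K' : comNzRingType) (f : {rmorphism K -> K'}) x :
  f (pentagonal B x) = pentagonal B (f x).
Proof.
by rewrite rmorph_sum; apply: eq_bigr => i _; rewrite rmorphD !rmorphXn.
Qed.

Lemma psi_morph (K K' : comNzRingType) (f : {rmorphism K -> K'}) x :
  f (psi B x) = psi B (f x).
Proof. by rewrite rmorph_sum; apply: eq_bigr => i _; rewrite rmorphXn. Qed.

Lemma euler_morph (K K' : comNzRingType) (f : {rmorphism K -> K'}) x :
  f (euler L x) = euler L (f x).
Proof.
by rewrite rmorph_prod; apply: eq_bigr => i _; rewrite rmorphB rmorph1 rmorphXn.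
Qed.

(** Both sides are free of w, so the identity descends along the injection. *)
Lemma cubic_identity (K : comNzRingType) (q : K) :
  5%:R = 0 :> K -> q ^+ L = 0 ->
  (pentagonal B (q ^+ 3) ^+ 3 - 8%:R * q ^+ 3 * psi B (q ^+ 9) ^+ 3)
    * (euler L (q ^+ 6) * euler L (q ^+ 9) ^+ 2) =
  euler L (q ^+ 3) ^+ 5 * euler L (q ^+ 18).
Proof.
have [K' [f [w [f_inj w0]]]] := exists_cube_root K.
move=> K5 q0; apply: f_inj.
have K5' : 5%:R = 0 :> K' by rewrite -(rmorph_nat f) K5 rmorph0.
have fq0 : f q ^+ L = 0 by rewrite -rmorphXn q0 rmorph0.
have := cubic_identity_of_cube_root K5' w0 fq0.
by rewrite -!rmorphXn -!euler_morph -psi_morph -pentagonal_morph -(rmorph_nat f 8)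
  -!(rmorphXn, rmorphM, rmorphB).
Qed.

End CubicIdentity.

(** * Dissection of G modulo 3 *)

Section Dissection.
Variables L B : nat.
Hypothesis ltLB : (L < B)%N.

(** Geometric series cut at L: as a polynomial in x, this inverse commutes with ring morphisms. *)
Definition inv_euler (K : comNzRingType) (x : K) :=
  \prod_(i < L) \sum_(j < L) (x ^+ i.+1) ^+ j.

Lemma inv_euler_morph (K K' : comNzRingType) (f : {rmorphism K -> K'}) x :
  f (inv_euler x) = inv_euler (f x).
Proof.
rewrite rmorph_prod; apply: eq_bigr => i _; rewrite rmorph_sum.
by apply: eq_bigr => j _; rewrite !rmorphXn.
Qed.

Lemma cubic_pentagonal_morph (K K' : comNzRingType) (f : {rmorphism K -> K'}) x :
  f (cubic_pentagonal B x) = cubic_pentagonal B (f x).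
Proof.
rewrite rmorph_sum; apply: eq_bigr => i _.
by rewrite rmorphB !rmorphM !rmorphXn !rmorphD rmorphN !rmorph_nat rmorph1.
Qed.

Lemma jacobi_morph (K K' : comNzRingType) (f : {rmorphism K -> K'}) x :
  f (jacobi B x) = jacobi B (f x).
Proof.
rewrite rmorph_sum; apply: eq_bigr => i _.
by rewrite !rmorphM rmorph_sign rmorph_nat rmorphXn.
Qed.

Section Ring.
Variables (K : comNzRingType).
Hypothesis K5 : 5%:R = 0 :> K.

Lemma inv_eulerK (x : K) : x ^+ L = 0 -> euler L x * inv_euler x = 1.
Proof.
move=> x0; rewrite -big_split big1 // => i _ /=.
rewrite -opprB mulNr -subrX1 exprAC x0 expr0n.
by case: L i => [[]|n i] //; rewrite sub0r opprK.
Qed.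

Lemma euler_exp5 (x : K) : euler L x ^+ 5 = euler L (x ^+ 5).
Proof.
rewrite -prodrXl; apply: eq_bigr => i _; rewrite [in RHS]exprAC.
move: (x ^+ i.+1) => y.
by apply: (eq_mod5 K5 (w := - y + 2%:R * y ^+ 2 - 2%:R * y ^+ 3 + y ^+ 4)); ring.
Qed.

(** At x = q^3 this is T f_6 f_9^2 / f_18, the part of G f_3^5 common to all three classes. *)
Definition diss_factor (x : K) := cubic_pentagonal B x * euler L (x ^+ 2)
  * euler L (x ^+ 3) ^+ 2 * inv_euler (x ^+ 6).
Definition diss1 (x : K) :=
  psi B x * jacobi B (x ^+ 3) * cubic_pentagonal B x.

End Ring.

Lemma diss_factor_morph (K K' : comNzRingType) (f : {rmorphism K -> K'}) x :
  f (diss_factor x) = diss_factor (f x).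
Proof.
rewrite /diss_factor !(rmorphXn, rmorphM) cubic_pentagonal_morph inv_euler_morph.
by rewrite !euler_morph !rmorphXn.
Qed.

Lemma diss1_morph (K K' : comNzRingType) (f : {rmorphism K -> K'}) x :
  f (diss1 x) = diss1 (f x).
Proof.
by rewrite /diss1 !rmorphM psi_morph jacobi_morph cubic_pentagonal_morph rmorphXn.
Qed.

(** With b = 2q psi(q^9), 1/P = 1/(a - b) = (a^2 + a b + b^2) / (a^3 - b^3), whose denominator is
    the norm. All else being in q^3, the summands are the classes 0, 1, 2 of exponents. *)
Lemma dissection (K : comNzRingType) (K5 : 5%:R = 0 :> K) (G q : K) : q ^+ L = 0 ->
  G * cheb_theta B 0 q = cheb_theta B 3 q ->
  G * euler L (q ^+ 15) = diss_factor (q ^+ 3) * pentagonal B (q ^+ 3) ^+ 2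
   + 2%:R * q * diss1 (q ^+ 3)
   + 4%:R * q ^+ 2 * (diss_factor (q ^+ 3) * psi B (q ^+ 9) ^+ 2).
Proof.
move=> q0; rewrite cheb_theta0 // cheb_theta3 //.
have q30 : (q ^+ 3) ^+ L = 0 by exact: nilp_exp.
have q90 : (q ^+ 9) ^+ L = 0 by exact: nilp_exp.
have q180 : (q ^+ 18) ^+ L = 0 by exact: nilp_exp.
have := pentagonal_euler q30 ltLB; have := psi_euler q30 ltLB.
have := psi_euler q90 ltLB; have := inv_eulerK q180.
have := cubic_identity ltLB K5 q0.
have -> : euler L (q ^+ 15) = euler L (q ^+ 3) ^+ 5 by rewrite (euler_exp5 K5) -exprM.
rewrite /diss_factor /diss1 -!exprM -(euler_cube q90 ltLB) /=.
have reg j : (0 < j)%N -> GRing.lreg (euler L (q ^+ j)).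
  by move=> j0; apply: (@lreg_euler _ _ L); exact: nilp_exp.
move: (reg 3 isT) (reg 9 isT) (reg 18 isT).
rewrite (_ : (3 * 2)%N = 6) // (_ : (3 * 3)%N = 9) // (_ : (9 * 2)%N = 18) //
  (_ : (3 * 6)%N = 18) //.
move: (euler L (q ^+ 3)) (euler L (q ^+ 6)) (euler L (q ^+ 9)) (euler L (q ^+ 18)).
move: (pentagonal _ _) (psi _ (q ^+ 3)) (psi _ (q ^+ 9)) (inv_euler _) (cubic_pentagonal _ _).
move=> a p3 p9 J T F3 F6 F9 F18 r3 r9 r18 cub F18J p9E p3E aE GE.
(* In the middle class the products for psi(q^9) and a(q^3) recombine into psi(q^3) f_9^3. *)
have mid : T * F6 * F9 ^+ 2 * J * p9 * a = p3 * F9 ^+ 3 * T.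
  apply: (lregM (lregX (n := 2) r18) (lregM r3 r9)).
  transitivity (T * F6 * F9 ^+ 2 * (F18 * J) * (p9 * F9) * (a * F3 * F18)).
    by ring.
  transitivity ((p3 * F3) * F9 ^+ 4 * T * F18 ^+ 2); last by ring.
  by rewrite F18J p9E p3E aE; ring.
transitivity (G * F3 ^+ 5 * (F18 * J)); first by rewrite F18J mulr1.
transitivity (G * (F3 ^+ 5 * F18) * J); first by ring.
rewrite -cub -mid.
transitivity ((G * (a - 2%:R * q * p9)) * (a ^+ 2 + 2%:R * q * p9 * a
   + 4%:R * q ^+ 2 * p9 ^+ 2) * F6 * F9 ^+ 2 * J); first by ring.
by rewrite GE; ring.
Qed.

End Dissection.

(** * G as an elementary symmetric function of the x_m *)

Section ElementarySymmetric.
Variable K : comNzRingType.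
Implicit Types x : nat -> K.

(** Monomials are sorted by their largest index k. *)
Lemma coef_prod_1addX x M j :
  (\prod_(i < M) (1 + (x i)%:P * 'X))`_j.+1 =
  \sum_(k < M) x k * (\prod_(i < k) (1 + (x i)%:P * 'X))`_j.
Proof.
elim: M => [|M IHM]; first by rewrite !big_ord0 coef1.
rewrite !big_ord_recr /= mulrDr mulr1 coefD IHM; congr (_ + _).
by rewrite mulrCA coefCM coefMX.
Qed.

Lemma coef3_prod_1addX x M :
  (\prod_(i < M) (1 + (x i)%:P * 'X))`_3 =
  \sum_(k < M) \sum_(j < k) \sum_(i < j) x i * x j * x k.
Proof.
rewrite coef_prod_1addX; apply: eq_bigr => k _.
rewrite coef_prod_1addX mulr_sumr; apply: eq_bigr => j _.
rewrite coef_prod_1addX !mulr_sumr; apply: eq_bigr => i _.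
rewrite -horner_coef0 horner_prod big1 ?mulr1; first by ring.
by move=> l _; rewrite !hornerE.
Qed.

(** Each factor is (1 - q^m + q^(2m)) (1 + z x_m), so the z^3- and z^0-coefficients differ by the
    factor e_3. *)
Lemma cheb_theta_sym3 L B (q : K) x : q ^+ L = 0 -> (L < B)%N ->
  (forall i, x i * (1 - q ^+ i.+1 + q ^+ i.*2.+2) = q ^+ i.+1) ->
  (\sum_(k < L) \sum_(j < k) \sum_(i < j) x i * x j * x k) * cheb_theta B 0 q
  = cheb_theta B 3 q.
Proof.
move=> q0 ltLB xE; rewrite -coef3_prod_1addX !(coef_cheb_product q0) //.
pose F i := 1 - q ^+ i.+1 + q ^+ i.*2.+2.
have -> : \prod_(i < L) (1 + ('X - 1) * (q ^+ i.+1)%:P + (q ^+ i.*2.+2)%:P) =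
   (\prod_(i < L) F i)%:P * \prod_(i < L) (1 + (x i)%:P * 'X).
  rewrite rmorph_prod -big_split /=; apply: eq_bigr => i _.
  rewrite mulrDr mulr1 mulrA -rmorphM /= [F i * _]mulrC xE /F rmorphD rmorphB rmorph1 /=.
  by ring.
rewrite !coefCM.
have -> : (\prod_(i < L) (1 + (x i)%:P * 'X))`_0 = 1.
  by rewrite -horner_coef0 horner_prod big1 // => l _; rewrite !hornerE.
by ring.
Qed.

End ElementarySymmetric.

(** * Triangular and pentagonal numbers modulo 5 *)

Lemma pent1_mul2 k : (pent1 k * 2 = k * (3 * k + 1))%N.
Proof. by elim: k => // k; rewrite /pent1 !binS !bin1 ?bin0; lia. Qed.

Lemma pent2_mul2 k : (pent2 k * 2 = k.+1 * (3 * k + 2))%N.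
Proof. by elim: k => // k; rewrite /pent2 !binS !bin1 ?bin0; lia. Qed.

Lemma bin2_mul2 k : ('C(k.+1, 2) * 2 = k.+1 * k)%N.
Proof. by elim: k => // k; rewrite !binS !bin1 ?bin0; lia. Qed.

Lemma mod5_cases k :
  exists m, [\/ k = 5 * m, k = 5 * m + 1, k = 5 * m + 2 | k = 5 * m + 3 \/ k = 5 * m + 4]%N.
Proof.
exists (k %/ 5)%N; have := ltn_pmod k (isT : (0 < 5)%N); move: (divn_eq k 5).
case: (k %% 5)%N => [|[|[|[|[|r]]]]] e // _;
  [constructor 1 | constructor 2 | constructor 3 | constructor 4; left
    | constructor 4; right]; lia.
Qed.

Lemma triangular_mod5 i : ('C(i.+1, 2) %% 5 \in [:: 0; 1; 3])%N.
Proof.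
by have := bin2_mul2 i; case: (mod5_cases i) => m [|||[]] ->; rewrite !inE; lia.
Qed.

(** The only class with T_j = 3 modulo 5 is j = 2, where 2j + 1 = 0. *)
Lemma triangular_mod5_weight j :
  (5 %| j.*2.+1)%N \/ ('C(j.+1, 2) %% 5 \in [:: 0; 1])%N.
Proof.
by have := bin2_mul2 j; case: (mod5_cases j) => m [|||[]] ->; rewrite !inE; lia.
Qed.

Lemma pent1_mod5_weight k :
  (5 %| k * (k + 1) * (k + 2))%N \/ (pent1 k %% 5 = 2)%N.
Proof.
have := pent1_mul2 k; case: (mod5_cases k) => m [|||[]] -> H.
- by left; rewrite -!mulnA dvdn_mulr.
- by right; lia.
- by right; lia.
- by left; rewrite dvdn_mull // (_ : _ + 2 = 5 * m.+1)%N ?dvdn_mulr //; lia.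
- by left; rewrite dvdn_mulr // dvdn_mull // (_ : _ + 1 = 5 * m.+1)%N ?dvdn_mulr //; lia.
Qed.

(** The factor k - 1 is written k + 4 to stay in the natural numbers. *)
Lemma pent2_mod5_weight k :
  (5 %| (k + 1) * k * (k + 4))%N \/ (pent2 k %% 5 = 2)%N.
Proof.
have := pent2_mul2 k; case: (mod5_cases k) => m [|||[]] -> H.
- by left; rewrite dvdn_mulr // dvdn_mull // dvdn_mulr.
- by left; rewrite dvdn_mull // (_ : _ + 4 = 5 * m.+1)%N ?dvdn_mulr //; lia.
- by right; lia.
- by right; lia.
- by left; rewrite dvdn_mulr // dvdn_mulr // (_ : _ + 1 = 5 * m.+1)%N ?dvdn_mulr //; lia.
Qed.

(** * Vanishing of the coefficients with exponent 4 modulo 5 *)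

Section Vanishing.
Variable R : comNzRingType.
Hypothesis R5 : 5%:R = 0 :> R.

Lemma natr_dvd5 m : (5 %| m)%N -> m%:R = 0 :> R.
Proof. by case/dvdnP=> d ->; rewrite natrM R5 mulr0. Qed.

(** A term surviving modulo 5 has exponent T_i + 3 T_j + 2 with T_i in {0, 1, 3} and T_j in {0, 1},
    which is never 4. *)
Lemma coef_diss1 B r : (diss1 B ('X : {poly R}))`_(5 * r + 4) = 0.
Proof.
rewrite /diss1 -mulrA /psi mulr_suml coef_sum big1 // => i _.
rewrite mulrA /cubic_pentagonal mulr_sumr coef_sum big1 // => k _.
rewrite /jacobi mulr_sumr mulr_suml coef_sum big1 // => j _; rewrite mulrBr.
rewrite (_ : _ - _ = (-1) ^+ j *
  ((j.*2.+1)%:R * (k * (k + 1) * (k + 2))%:R * 'X^('C(i.+1, 2) + 3 * 'C(j.+1, 2) + pent1 k)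
  - (j.*2.+1)%:R * ((k + 1) * k * (k + 4))%:R * 'X^('C(i.+1, 2) + 3 * 'C(j.+1, 2) + pent2 k)));
  last first.
  have R5P : 5%:R = 0 :> {poly R} by rewrite -(rmorph_nat (@polyC R)) R5.
  rewrite -exprM !exprD !natrM !natrD.
  have -> : k%:R + 4%:R = k%:R - 1 :> {poly R}.
    by apply: (eq_mod5 R5P (w := 1)); ring.
  by ring.
rewrite -(rmorph_sign (@polyC R)) coefCM; apply/eqP; rewrite coefB -!natrM.
rewrite -!(rmorph_nat (@polyC R)) !coefCM !coefXn -!natrM.
have [d1|j1] := triangular_mod5_weight j.
  by rewrite !natr_dvd5 ?subr0 ?mulr0 // !dvdn_mulr.
rewrite [X in X - _](_ : _ = 0); last first.
  have [d|k1] := pent1_mod5_weight k; first by rewrite natr_dvd5 // dvdn_mulr // dvdn_mull.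
  rewrite (_ : _ == _ = false) ?muln0 //; apply/eqP.
  by have := triangular_mod5 i; move: j1; rewrite !inE; lia.
rewrite [X in _ - X](_ : _ = 0) ?subr0 ?mulr0 //.
have [d|k1] := pent2_mod5_weight k; first by rewrite natr_dvd5 // dvdn_mulr // dvdn_mull.
rewrite (_ : _ == _ = false) ?muln0 //; apply/eqP.
by have := triangular_mod5 i; move: j1; rewrite !inE; lia.
Qed.

End Vanishing.

(** * Polynomials modulo X^L *)

Section Truncation.
Variables (R : comNzRingType) (L : nat).
Hypothesis L_gt0 : (0 < L)%N.

Lemma coef_in_qpolyXn (p : {poly R}) i : (i < L)%N ->
  (in_qpoly 'X^L p : {poly R})`_i = p`_i.
Proof.
(* For L = 0 the modulus would default to X; L > 0 excludes this. *)
move=> ltiL; rewrite /= mk_monic_Xn prednK //.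
rewrite [in RHS](Pdiv.RingMonic.rdivp_eq (monicXn R L) p) coefD coefMXn ltiL.
by rewrite add0r.
Qed.

Lemma in_qpolyXn_eq (x y : {poly %/ ('X^L : {poly R})}) :
  (forall i, (i < L)%N -> (x : {poly R})`_i = (y : {poly R})`_i) -> x = y.
Proof.
move=> e; apply/val_inj/polyP => i /=; have [|leLi] := ltnP i L; first exact: e.
have sz (z : {poly %/ ('X^L : {poly R})}) : (size (z : {poly R}) <= L)%N.
  rewrite -ltnS; apply: leq_trans (size_mk_monic z) _.
  by rewrite mk_monic_Xn prednK // size_polyXn.
by rewrite !nth_default // (leq_trans (sz _)).
Qed.

Lemma in_qpolyXn_nilp : (in_qpoly ('X^L : {poly R}) 'X) ^+ L = 0.
Proof.
rewrite -rmorphXn; apply: in_qpolyXn_eq => i ltiL.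
by rewrite coef_in_qpolyXn // coefXn ltn_eqF ?coef0.
Qed.

End Truncation.

(** * Truncation of the series defining MO *)

Section TruncatedSeries.
Variables (R : comNzRingType) (L : nat).
Hypothesis L_gt0 : (0 < L)%N.

Local Notation K := {poly %/ ('X^L : {poly R})}.

Definition fps_trunc (f : fps int) : K :=
  in_qpoly 'X^L (\poly_(i < L) (f i)%:~R).

Lemma coef_fps_trunc f i : (i < L)%N -> (fps_trunc f : {poly R})`_i = (f i)%:~R.
Proof. by move=> ltiL; rewrite coef_in_qpolyXn // coef_poly ltiL. Qed.

Lemma fps_truncM f g : fps_trunc (fps_mul f g) = fps_trunc f * fps_trunc g.
Proof.
rewrite -rmorphM; apply: in_qpolyXn_eq => // i ltiL.
rewrite !coef_in_qpolyXn // coef_poly ltiL coefM rmorph_sum.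
apply: eq_bigr => j _; rewrite !coef_poly rmorphM /=.
by rewrite !ifT //; have := ltn_ord j; lia.
Qed.

Lemma fps_trunc_poly p :
  fps_trunc (fps_of_poly p) = in_qpoly 'X^L (map_poly intr p).
Proof.
apply: in_qpolyXn_eq => // i ltiL.
by rewrite coef_fps_trunc // coef_in_qpolyXn // coef_map.
Qed.

Lemma fps_trunc1 : fps_trunc (fps_one int) = 1.
Proof. by rewrite fps_trunc_poly rmorph1 rmorph1. Qed.

Lemma fps_trunc_sum (I : Type) (r : seq I) (P : pred I) (f : I -> fps int) :
  fps_trunc (fun n => \sum_(i <- r | P i) f i n) = \sum_(i <- r | P i) fps_trunc (f i).
Proof.
apply: in_qpolyXn_eq => // n ltnL.
rewrite coef_fps_trunc // rmorph_sum poly_of_qpoly_sum coef_sum.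
by apply: eq_bigr => i _; rewrite coef_fps_trunc.
Qed.

Definition MO_part (i : nat) : K :=
  in_qpoly 'X^L 'X ^+ i.+1 * fps_trunc (MO_factor (-1) i.+1).

Lemma MO_partE (q := in_qpoly ('X^L : {poly R}) 'X) i :
  MO_part i * (1 - q ^+ i.+1 + q ^+ i.*2.+2) = q ^+ i.+1.
Proof.
rewrite /MO_part -mulrA; set u := (X in _ * X).
suff -> : u = 1 by rewrite mulr1.
rewrite -fps_trunc1 -(@MO_factorP (-1) i.+1) // fps_truncM fps_trunc_poly.
congr (_ * _); rewrite /q -!rmorphXn -(rmorph1 (in_qpoly _)) -rmorphB -rmorphD.
congr (in_qpoly _ _); rewrite !rmorphD rmorph1 /= map_polyZ !map_polyXn.
by rewrite rmorphN1 scaleN1r; congr (_ + 'X^_); lia.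
Qed.

Definition tuple3 (i j k : nat) : 3.-tuple nat := [tuple i.+1; j.+1; k.+1].

Lemma fps_trunc_MO_term i j k :
  fps_trunc (MO_term (-1) (tuple3 i j k)) = MO_part i * MO_part j * MO_part k.
Proof.
rewrite /MO_term fps_truncM fps_trunc_poly map_polyXn.
rewrite (big_morph fps_trunc fps_truncM fps_trunc1) !big_cons !big_nil.
by rewrite rmorphXn /MO_part !exprD /=; ring.
Qed.

End TruncatedSeries.

(** A triple with an entry above L has sum above n, so its term has no q^n. Indices are shifted by
    one, as parts start at 1. *)
Lemma MO3E L n : (n < L)%N ->
  MO (-1) 3 n = \sum_(k < L) \sum_(j < k) \sum_(i < j) MO_term (-1) (tuple3 i j k) n.
Proof.
move=> ltnL; pose phi (u : 'I_L * 'I_L * 'I_L) := tuple3 u.2 u.1.2 u.1.1.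
pose D := [pred u : 'I_L * 'I_L * 'I_L | (u.1.2 < u.1.1)%N && (u.2 < u.1.2)%N].
have phi_inj : injective phi.
  move=> [[c b] a] [[c' b'] a'] /(congr1 (fun s : 3.-tuple nat => val s)) [].
  by move=> /val_inj -> /val_inj -> /val_inj ->.
transitivity (\sum_(s \in phi @` [set` D]) MO_term (-1) s n).
  symmetry; apply: fsbig_widen.
    move=> _ [[[c b] a] /= /andP[bc ab] <-]; split; first by rewrite /= !ltnS ab bc.
    by move=> m; rewrite !inE => /or3P[] /eqP ->.
  move=> s [[sorted_s s_gt0] notin]; apply: MO_term_eq0; rewrite ltnNge.
  apply/negP => le_sn; apply: notin.
  case: s sorted_s s_gt0 le_sn => [[|a [|b [|c [|d s]]]] //= sz].
  rewrite !big_cons big_nil addn0 andbT => /andP[ab bc] s_gt0 le_sn.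
  have a_gt0 : (0 < a)%N by apply: s_gt0; rewrite mem_head.
  have [aL bL cL] : [/\ (a.-1 < L)%N, (b.-1 < L)%N & (c.-1 < L)%N] by split; lia.
  exists (Ordinal cL, Ordinal bL, Ordinal aL); first by apply/andP; split=> /=; lia.
  by apply: val_inj => /=; rewrite !prednK //; lia.
rewrite fsbig_image; last by move=> u v _ _; apply: phi_inj.
rewrite -(@bigfs _ _ _ _ (index_enum _)) ?index_enum_uniq //; last first.
  by move=> u; rewrite mem_index_enum.
(* The inner ranges are widened to L under conditions, to match the sum over [D]. *)
under [RHS]eq_bigr => k _.
  rewrite (big_ord_widen L (fun j => \sum_(i < j) MO_term (-1) (tuple3 i j k) n));
    last exact/ltnW/ltn_ord.
  under eq_bigr => j _.
    rewrite (big_ord_widen L (fun i => MO_term (-1) (tuple3 i j k) n));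
      last exact/ltnW/ltn_ord.
    over.
  over.
by rewrite [RHS]pair_big_dep [RHS]pair_big_dep.
Qed.

(** * Extraction of the coefficients of exponent 15n + 13 *)

Section Coefficients.
Variables (R : comNzRingType) (L : nat).
Hypotheses (L_gt0 : (0 < L)%N) (R5 : 5%:R = 0 :> R).

Local Notation K := {poly %/ ('X^L : {poly R})}.

Lemma fps_trunc_MO3 : fps_trunc R L (MO (-1) 3) =
  \sum_(k < L) \sum_(j < k) \sum_(i < j)
    MO_part R L i * MO_part R L j * MO_part R L k.
Proof.
rewrite -[RHS](_ : fps_trunc R L (fun n => \sum_(k < L) \sum_(j < k) \sum_(i < j)
    MO_term (-1) (tuple3 i j k) n) = _); last first.
  rewrite fps_trunc_sum //; apply: eq_bigr => k _.
  rewrite fps_trunc_sum //; apply: eq_bigr => j _.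
  rewrite fps_trunc_sum //; apply: eq_bigr => i _.
  exact: fps_trunc_MO_term.
by apply: in_qpolyXn_eq => // n ltnL; rewrite !coef_fps_trunc // (MO3E ltnL).
Qed.

(** Here [dissection] is lifted to polynomials: [f] and [f15] substitute X^3 and X^15 and then
    reduce. Only the class 1 needs an explicit form. *)
Lemma MO3_dissection :
  exists u0 u2 : {poly R},
  in_qpoly 'X^L ((\poly_(i < L) (MO (-1) 3 i)%:~R) * (euler L 'X \Po 'X^15)) =
  in_qpoly 'X^L ((u0 \Po 'X^3) + 2%:R * ('X * (diss1 L.+1 'X \Po 'X^3))
    + 4%:R * ('X^2 * (u2 \Po 'X^3))) :> K.
Proof.
have q0 := in_qpolyXn_nilp R L_gt0; set q := in_qpoly _ _ in q0.
have K5 : 5%:R = 0 :> K.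
  by rewrite -(rmorph_nat (in_qpoly ('X^L : {poly R}))) -(rmorph_nat (@polyC R)) R5 !rmorph0.
have ltLB := ltnSn L.
have := cheb_theta_sym3 q0 ltLB (@MO_partE R L L_gt0); rewrite -fps_trunc_MO3.
move=> /(dissection ltLB K5 q0) e.
pose f : {rmorphism {poly R} -> K} := (in_qpoly 'X^L \o comp_poly 'X^3)%FUN.
have fX : f 'X = q ^+ 3 by rewrite /= comp_polyX rmorphXn.
exists (diss_factor L L.+1 'X * pentagonal L.+1 'X ^+ 2),
  (diss_factor L L.+1 'X * psi L.+1 ('X ^+ 3) ^+ 2).
pose f15 : {rmorphism {poly R} -> K} := (in_qpoly 'X^L \o comp_poly 'X^15)%FUN.
rewrite rmorphM -[X in _ * X]/(f15 _) euler_morph.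
have -> : f15 'X = q ^+ 15 by rewrite /= comp_polyX rmorphXn.
rewrite -[X in X * _]/(fps_trunc R L (MO (-1) 3)) e.
rewrite -[2%:R * q * _]mulrA -[4%:R * q ^+ 2 * _]mulrA !rmorphD.
rewrite !(rmorphM (in_qpoly ('X^L : {poly R}))) !(rmorph_nat (in_qpoly ('X^L : {poly R}))).
have fE u : in_qpoly 'X^L (u \Po 'X^3) = f u by [].
rewrite /= -/q !fE.
have dfE := diss_factor_morph L L.+1 f 'X.
rewrite (rmorphM f (diss_factor _ _ _)) (rmorphM f (diss_factor _ _ _)) dfE.
rewrite !(rmorphXn f _ (pentagonal _ _)) !(rmorphXn f _ (psi _ _)).
rewrite (pentagonal_morph L.+1 f) (psi_morph L.+1 f) (diss1_morph L.+1 f).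
by rewrite (rmorphXn f _ 'X) fX -!exprM.
Qed.

(** As 15n + 13 = 3(5n + 4) + 1, the coefficient of G f_15 vanishes by [coef_diss1]. Since f_15 has
    constant term 1 and exponents divisible by 15, this coefficient is the wanted one plus multiples
    of those at 15i + 13, i < n. *)
Lemma MO3_mod5_vanishing n :
  (forall i, (i < n)%N -> (MO (-1) 3 (15 * i + 13))%:~R = 0 :> R) ->
  (L = 15 * n + 14)%N -> (MO (-1) 3 (15 * n + 13))%:~R = 0 :> R.
Proof.
move=> IH LE; have [u0 [u2 /(congr1 (fun x : K => (x : {poly R})`_(15 * n + 13)))]] :=
  MO3_dissection.
have lt_nL : (15 * n + 13 < L)%N by lia.
rewrite !coef_in_qpolyXn // !coefD.
rewrite -!(rmorph_nat (@polyC R)) !coefCM ['X * (_ \Po _)]mulrC coefMX.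
rewrite ['X^2 * _]mulrC coefMXn !coef_comp_poly_Xn //.
have nd m : (m %% 3 != 0)%N -> (3 %| m)%N = false by rewrite /dvdn => /negPf.
rewrite [(3 %| _)%N]nd; last by lia.
rewrite ifF; last by lia.
have -> : ((15 * n + 13).-1 = 3 * (5 * n + 4))%N by lia.
rewrite dvdn_mulr // mulKn // coef_diss1 // ifF; last by lia.
rewrite ifF; last by apply: nd; lia.
rewrite !mulr0 !addr0 coefM big_ord_recr /= subnn coef_poly lt_nL.
rewrite coef_comp_poly_Xn //= big1 => [|[i lti] _] /=.
  rewrite add0r -horner_coef0 /euler horner_prod big1 ?mulr1 // => l _.
  by rewrite !hornerE expr0n subr0.
rewrite coef_poly coef_comp_poly_Xn //; case: ifP => [ltiL|_]; last by rewrite mul0r.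
case: ifP => [/dvdnP[c ec]|_]; last by rewrite mulr0.
rewrite (_ : i = 15 * (n - c) + 13)%N; last by lia.
by rewrite IH ?mul0r //; lia.
Qed.
End Coefficients.

Theorem theorem4p3 (N : nat) : (MO (-1) 3 (15 * N + 13) = 0 %[mod 5])%Z.
Proof.
have F5 : 5%:R = 0 :> 'F_5 by apply/val_inj.
have /eqP : (MO (-1) 3 (15 * N + 13))%:~R = 0 :> 'F_5.
  elim/ltn_ind: N => n IHn.
  (* This L is the least that keeps the coefficient of index 15n + 13. *)
  by apply: (@MO3_mod5_vanishing _ (15 * n + 14)) => //; rewrite addnS.
by rewrite -(dvdz_pcharf (pchar_Fp (isT : prime 5))) => /dvdz_mod0P.
Qed.
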